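(* Let $K,L\subset\mathbb{R}^n$ be convex bodies and $j\in\{0,\ldots,n\}$. Then $$\max\left\{\frac{\alpha_j(K)}{\alpha_j(L)},\frac{\alpha_j(L)}{\alpha_j(K)}\right\}\le \frac{R(K,L)}{r(K,L)}=\frac{R(L,K)}{r(L,K)}.$$ Moreover, for every convex body $K\subset\mathbb{R}^n$ and every $\beta\in[1,\alpha_j(K)]$, there exists a convex body $L\subset\mathbb{R}^n$ with $\alpha_j(L)=\beta$ and $$\max\left\{\frac{\alpha_j(K)}{\alpha_j(L)},\frac{\alpha_j(L)}{\alpha_j(K)}\right\}= \frac{R(K,L)}{r(K,L)}.$$
   Context: A convex body is a compact convex set with nonempty interior. For convex bodies $K,C\subset\mathbb{R}^n$, the circumradius and inradius of $K$ with respect to $C$ are $R(K,C)=\inf\{\lambda>0 : K\subset z+\lambda C\text{ for some }z\in\mathbb{R}^n\}$ and $r(K,C)=\sup\{\lambda>0 : z+\lambda C\subset K\text{ for some }z\in\mathbb{R}^n\}$. For an affine subspace $U\subset\mathbb{R}^n$, $P_U$ is the orthogonal projection onto $U$ and $\Phi_U(x)=2P_U(x)-x$ is the reflection across $U$. The $j$th Minkowski chirality is $\alpha_j(K)=\inf\{R(K,\Phi_U(K)) : U\subset\mathbb{R}^n\text{ affine subspace},\ \dim U=j\}$. *)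

(* Defs.v *)
From HB Require Import structures.
From mathcomp Require Import all_boot all_order all_algebra.
From mathcomp Require Import all_classical all_reals all_analysis.

Set Implicit Arguments.
Unset Strict Implicit.
Unset Printing Implicit Defensive.

Import Order.TTheory GRing.Theory Num.Theory.
Import numFieldNormedType.Exports.

Local Open Scope classical_set_scope.
Local Open Scope ring_scope.

Section Defs.
Context {R : realType} {n : nat}.
Implicit Types (K C U : set 'rV[R]_n) (a x p u : 'rV[R]_n).

Definition convex_body K := [/\ compact K, convex_set K & K° !=set0].

Definition homothet z (l : R) C : set 'rV[R]_n := [set z + l *: x | x in C].

(* inf and sup are real-valued. For convex bodies K and C and 0 < n the sets below *)
(* are nonempty, bounded below resp. above; for n = 0 the circumradius is 0 and *)
(* the inradius, a supremum of an unbounded set, defaults to 0. *)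
Definition circumradius K C : R :=
  inf [set l : R | 0 < l /\ exists z, K `<=` homothet z l C].

Definition inradius K C : R :=
  sup [set l : R | 0 < l /\ exists z, homothet z l C `<=` K].

(* The affine subspace through a whose direction is the row space of V. *)
Definition flat a (V : 'M[R]_n) : set 'rV[R]_n := [set x | (x - a <= V)%MS].

Definition affine_subspace (j : nat) U :=
  exists a (V : 'M[R]_n), \rank V = j /\ U = flat a V.

(* The foot p in U of the perpendicular from x to U; *)
(* lemma orthprojE gives it explicitly, so for affine U the default value x is not used. *)
Definition orthproj U x : 'rV[R]_n :=
  xget x [set p | U p /\ forall u, U u -> (x - p) *m (u - p)^T = 0].

Definition reflection U x : 'rV[R]_n := 2 *: orthproj U x - x.

Definition chirality (j : nat) K : R :=
  inf [set circumradius K (reflection U @` K) | U in affine_subspace j].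

Lemma mulmx_tr_eq0 x : x *m x^T = 0 -> x = 0.
Proof.
move=> /matrixP/(_ 0 0); rewrite !mxE => /eqP.
rewrite psumr_eq0 => [/allP x0|i _]; last by rewrite mxE -expr2 sqr_ge0.
apply/rowP => i; have /= := x0 i (mem_index_enum i).
by rewrite !mxE mulf_eq0 orbb => /eqP.
Qed.

Lemma capmx_kermx_tr (V : 'M[R]_n) : (V :&: kermx V^T = 0)%MS.
Proof.
apply/eqP; rewrite -submx0; apply/rV_subP => u; rewrite sub_capmx.
move=> /andP[/submxP[w uE] /sub_kermxP uV]; rewrite submx0; apply/eqP.
by apply: mulmx_tr_eq0; rewrite {2}uE trmx_mul mulmxA uV mul0mx.
Qed.

Lemma addsmx_kermx_tr (V : 'M[R]_n) x : (x <= V + kermx V^T)%MS.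
Proof.
apply: submx_full; rewrite -col_leq_rank -(leq_add2r (\rank (V :&: kermx V^T)%MS)).
by rewrite mxrank_sum_cap mxrank_ker mxrank_tr subnKC ?rank_leq_col//
  capmx_kermx_tr mxrank0 addn0.
Qed.

Lemma orthprojE a (V : 'M[R]_n) x :
  orthproj (flat a V) x = a + (x - a) *m proj_mx V (kermx V^T).
Proof.
set q := (RHS).
have qV : (q - a <= V)%MS by rewrite addrC addKr proj_mx_sub.
have xq : (x - q) *m V^T = 0.
  apply/sub_kermxP; rewrite /q opprD addrA.
  by apply: proj_mx_compl_sub; exact: addsmx_kermx_tr.
have perp v : (v <= V)%MS -> (x - q) *m v^T = 0.
  by move=> /submxP[w ->]; rewrite trmx_mul mulmxA xq mul0mx.
have subV y z : (y - a <= V)%MS -> (z - a <= V)%MS -> (y - z <= V)%MS.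
  by move=> yV zV; rewrite -[y - z](subrKA a) -[a - z]opprB
    addmx_sub ?eqmx_opp.
rewrite /orthproj; case: xgetP => [p _ [pV pP]|/(_ q)]; last first.
  by case; split=> // u uV; apply: perp; exact: subV.
have -> : p = q; last by [].
apply/esym/subr0_eq/mulmx_tr_eq0.
rewrite -{1}[q - p](subrKA x) mulmxDl (pP _ qV) addr0.
by rewrite -[q - x]opprB mulNmx perp ?oppr0//; exact: subV.
Qed.

End Defs.

(* Main.v *)
Require Import Defs.
From mathcomp Require Import all_boot all_order all_algebra.
From mathcomp Require Import all_classical all_reals all_analysis.
From mathcomp Require Import ring lra.

Set Implicit Arguments.
Unset Strict Implicit.
Unset Printing Implicit Defensive.

Import Order.TTheory GRing.Theory Num.Theory.
Import numFieldNormedType.Exports.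

Local Open Scope classical_set_scope.
Local Open Scope ring_scope.

(** Exchanging inner and outer covers gives r(K,L) = 1/R(L,K), so that
    R(K,L)/r(K,L) = R(K,L)R(L,K); the bound follows from submultiplicativity,
    R(K,ΦK) <= R(K,L) R(L,ΦL) R(ΦL,ΦK), and the affine invariance of R.

    For sharpness, compactness of the set of orthogonal projections of rank j
    shows that α = α_j(K) is attained by some reflection Φ. If α > 1, then after a
    translation K ⊂ αΦK with Φ linear, and L = K ∩ βΦK satisfies (β/α)K ⊂ L ⊂ K and
    L ⊂ βΦL. Hence R(K,L)R(L,K) <= α/β and α_j(L) <= β, and the bound forces
    equality in both. *)

(** * Infima of sets of positive reals *)

Section PositiveInf.
Context {R : realType}.
Implicit Types S T : set R.

Definition positive_set S := forall s, S s -> 0 < s.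

Lemma inf_positive_ge0 S : positive_set S -> 0 <= inf S.
Proof.
move=> S0; have [->|/set0P Sn] := eqVneq S set0; first by rewrite inf0.
by apply: lb_le_inf => // s /S0/ltW.
Qed.

Lemma inf_positive_le S s : positive_set S -> S s -> inf S <= s.
Proof. by move=> S0; apply: ge_inf; exists 0 => x /S0/ltW. Qed.

(** Inversion reverses the order of positive reals. The default values fit: if [S] is empty both
    sides are 0, and if [inf S = 0] the inverses are unbounded, so their [sup] is 0 as well. *)
Lemma sup_inv S : positive_set S -> sup [set s^-1 | s in S] = (inf S)^-1.
Proof.
move=> S0; have [->|/set0P Sn] := eqVneq S set0.
  by rewrite image_set0 sup0 inf0 invr0.
have [s0 Ss0] := Sn.
have Vn : [set s^-1 | s in S] !=set0 by exists s0^-1, s0.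
have := inf_positive_ge0 S0; rewrite le_eqVlt => /predU1P[i0|i0].
  rewrite -i0 invr0 sup_out// => -[_ [u uV]].
  have u0 : 0 < u.
    have : s0^-1 <= u by apply: uV; exists s0.
    by apply: lt_le_trans; rewrite invr_gt0 S0.
  suff : u^-1 <= inf S by rewrite -i0 leNgt invr_gt0 u0.
  apply: lb_le_inf => // s Ss.
  by rewrite -[s]invrK lef_pV2 ?posrE ?invr_gt0// ?S0//; apply: uV; exists s.
have ubV : ubound [set s^-1 | s in S] (inf S)^-1.
  move=> _ [s Ss <-].
  by rewrite lef_pV2 ?posrE// ?S0//; exact: inf_positive_le.
apply/eqP; rewrite eq_le ge_sup//=.
have sV s : S s -> s^-1 <= sup [set s^-1 | s in S].
  by move=> Ss; apply: ub_le_sup; [exists (inf S)^-1 | exists s].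
have sup0 : 0 < sup [set s^-1 | s in S].
  by apply: lt_le_trans (sV s0 Ss0); rewrite invr_gt0 S0.
rewrite -[sup _]invrK lef_pV2 ?posrE ?invr_gt0//.
apply: lb_le_inf => // s Ss.
by rewrite -[s]invrK lef_pV2 ?posrE ?invr_gt0// ?S0//; exact: sV.
Qed.

Lemma le_mul_inf S (a b : R) : S !=set0 -> 0 <= b ->
  (forall s, S s -> a <= b * s) -> a <= b * inf S.
Proof.
move=> Sn; rewrite le_eqVlt => /predU1P[<-|b0] aS.
  by have [s /aS] := Sn; rewrite !mul0r.
rewrite mulrC -ler_pdivrMr//; apply: lb_le_inf => // s /aS.
by rewrite ler_pdivrMr// mulrC.
Qed.

End PositiveInf.

(** * Circumradius: duality with the inradius, submultiplicativity, affine maps *)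

Section Circumradius.
Context {R : realType} {n : nat}.
Implicit Types (K C D L : set 'rV[R]_n) (z w : 'rV[R]_n) (l m : R).

Lemma homothet_trans K C D z w l m : K `<=` homothet z l C ->
  C `<=` homothet w m D -> K `<=` homothet (z + l *: w) (l * m) D.
Proof.
move=> KC CD x /KC[y /CD[u Du <-] <-]; exists u => //.
by rewrite scalerDr addrA scalerA.
Qed.

Lemma sub_homothet_inv C D z l : l != 0 ->
  homothet z l C `<=` D -> C `<=` homothet (- (l^-1 *: z)) l^-1 D.
Proof.
move=> l0 CD x Cx; exists (z + l *: x); first by apply: CD; exists x.
by rewrite scalerDr addKr scalerA mulVf// scale1r.
Qed.

Lemma homothet_inv_sub C D z l : l != 0 ->
  C `<=` homothet z l D -> homothet (- (l^-1 *: z)) l^-1 C `<=` D.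
Proof.
move=> l0 CD _ [x /CD[y Dy <-] <-].
by rewrite scalerDr addKr scalerA mulVf// scale1r.
Qed.

Definition cover_factors K C : set R :=
  [set l | 0 < l /\ exists z, K `<=` homothet z l C].

Lemma cover_factors_gt0 K C : positive_set (cover_factors K C).
Proof. by move=> l []. Qed.

Lemma circumradius_ge0 K C : 0 <= circumradius K C.
Proof. exact/inf_positive_ge0/cover_factors_gt0. Qed.

Lemma circumradius_le K C z l :
  0 < l -> K `<=` homothet z l C -> circumradius K C <= l.
Proof.
move=> l0 KC; apply: inf_positive_le; first exact: cover_factors_gt0.
by split=> //; exists z.
Qed.

(** Inverting the homothety turns [z + l C] inside [K] into [C] inside [- z / l + K / l], so the
    inner factors are the inverses of the cover factors of [C] by [K]. *)
Lemma inradiusE K C : inradius K C = (circumradius C K)^-1.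
Proof.
rewrite -sup_inv; last exact: cover_factors_gt0.
congr sup; apply/seteqP; split=> [l [l0 [z CK]]|_ [l [l0 [z CK]] <-]].
  exists l^-1; last exact: invrK.
  split; first by rewrite invr_gt0.
  by exists (- (l^-1 *: z)); apply: sub_homothet_inv CK; rewrite gt_eqF.
split; first by rewrite invr_gt0.
by exists (- (l^-1 *: z)); apply: homothet_inv_sub CK; rewrite gt_eqF.
Qed.

Lemma cover_factors_nonempty K C :
  compact K -> C° !=set0 -> cover_factors K C !=set0.
Proof.
move=> /compact_bounded[M [_ KM]] [c /nbhs_ballP[/= e e0 eC]].
have {}KM x : K x -> `|x| <= `|M| + 1.
  by apply: KM; rewrite (le_lt_trans (ler_norm M))// ltrDl.
(* Division by [l] brings [K] into the closed ball of radius [e / 2] about 0, which fits into [C]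
   after a shift by [c]. *)
pose l := (`|M| + 1) / (e / 2).
have l0 : 0 < l by rewrite /l; have := normr_ge0 M; move=> ?; rewrite divr_gt0//; lra.
exists l; split=> //; exists (- (l *: c)) => x /KM xM.
exists (c + l^-1 *: x).
  apply: eC; rewrite -ball_normE /ball_/= opprD addNKr normrN normrZ.
  rewrite gtr0_norm ?invr_gt0// mulrC ltr_pdivrMr// (le_lt_trans xM)//.
  have -> : e * l = 2 * (`|M| + 1) by rewrite /l; field; rewrite gt_eqF.
  by have := normr_ge0 M; lra.
by rewrite scalerDr addKr scalerA mulfV ?scale1r// gt_eqF.
Qed.

Lemma circumradius_mul K C D : cover_factors K C !=set0 ->
  cover_factors C D !=set0 ->
  circumradius K D <= circumradius K C * circumradius C D.
Proof.
move=> KCn CDn; apply: le_mul_inf => //; first exact: circumradius_ge0.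
move=> m [m0 [w CD]]; rewrite mulrC; apply: le_mul_inf => //; first exact: ltW.
move=> l [l0 [z KC]]; rewrite mulrC.
by apply: (circumradius_le _ (homothet_trans KC CD)); rewrite mulr_gt0.
Qed.

(** The image of a cover has the same factor; its translation absorbs the effect of scaling on [c].
    Nonemptiness keeps the right-hand side from being the default infimum 0 of the empty set. *)
Lemma circumradius_affine (c : 'rV[R]_n) (M : 'M[R]_n) K C :
  cover_factors K C !=set0 ->
  circumradius [set c + x *m M | x in K] [set c + x *m M | x in C]
    <= circumradius K C.
Proof.
move=> KCn; apply: lb_le_inf => // l [l0 [z KC]].
apply: (@circumradius_le _ _ (c + z *m M - l *: c) l) => // _ [_ /KC[y Cy <-] <-].
exists (c + y *m M); first by exists y.
by rewrite scalerDr addrA addrNK mulmxDl -scalemxAl addrA.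
Qed.

End Circumradius.

(** * Orthogonal projections and reflections as matrices *)

Lemma mxtrace_idem (F : fieldType) (n : nat) (P : 'M[F]_n) :
  P *m P = P -> \tr P = (\rank P)%:R.
Proof.
move=> PP; rewrite -{1}(mulmx_base P) mxtrace_mulC.
(* In the rank factorisation of [P], cancelling the outer factors in [P *m P = P] leaves an identity
   matrix of size [\rank P]. *)
suff -> : row_base P *m col_base P = 1%:M by rewrite mxtrace1.
apply: (row_full_inj (col_base_full P)); apply: (row_free_inj (row_base_free P)).
by rewrite mulmx1 mulmxA mulmx_base -mulmxA mulmx_base PP.
Qed.

Section Reflections.
Context {R : realType} {n : nat}.
Implicit Types (P V : 'M[R]_n) (K L : set 'rV[R]_n).

(* The trace of an idempotent is its rank; unlike the rank it is continuous. *)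
Definition orthproj_mx (j : nat) P :=
  [/\ P^T = P, P *m P = P & \tr P = j%:R].

Definition refl_mx P : 'M[R]_n := 2 *: P - 1%:M.

Lemma orthproj_mx_rank j P : orthproj_mx j P -> \rank P = j.
Proof.
by move=> [_ PP]; rewrite mxtrace_idem// => /eqP; rewrite eqr_nat => /eqP.
Qed.

Lemma refl_mx_invol j P : orthproj_mx j P -> refl_mx P *m refl_mx P = 1%:M.
Proof.
move=> [_ PP _]; rewrite /refl_mx mulmxBl mul1mx mulmxBr mulmx1 -scalemxAl.
by rewrite -scalemxAr PP; apply/matrixP => i k; rewrite !mxE; ring.
Qed.

Lemma orthproj_mx_flat V :
  orthproj_mx (\rank V) (proj_mx V (kermx V^T)).
Proof.
set P := proj_mx _ _.
have PP : P *m P = P.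
  by rewrite proj_mx_id ?capmx_kermx_tr// -{1}[P]mul1mx proj_mx_sub.
have rP : \rank P = \rank V.
  apply/eqP; rewrite eqn_leq mxrankS; last by rewrite -[P]mul1mx proj_mx_sub.
  by rewrite -{1}(proj_mx_id (capmx_kermx_tr V) (submx_refl V)) mxrankM_maxr.
split=> //; last by rewrite mxtrace_idem// rP.
have VP : (1%:M - P) *m V^T = 0.
  apply/row_matrixP => i; rewrite row_mul row0; apply/sub_kermxP.
  rewrite linearB/= -[X in _ - row i X]mul1mx row_mul.
  by apply: proj_mx_compl_sub; exact: addsmx_kermx_tr.
have /submxP[W PW] : (P <= V)%MS by rewrite -[P]mul1mx proj_mx_sub.
(* This gives [P^T = P *m P^T], whose right-hand side is symmetric. *)
have : (1%:M - P) *m P^T = 0 by rewrite {2}PW trmx_mul mulmxA VP mul0mx.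
rewrite mulmxBl mul1mx => /subr0_eq PPT.
move: PPT; clearbody P => PPT.
by have := congr1 trmx PPT; rewrite trmx_mul !trmxK -PPT => <-.
Qed.

Lemma reflection_flat a V : exists c, reflection (flat a V) =
  (fun x => c + x *m refl_mx (proj_mx V (kermx V^T))).
Proof.
set P := proj_mx _ _; exists (2 *: (a - a *m P)); apply/funext => x.
rewrite /reflection orthprojE -/P mulmxBl mulmxBr mulmx1 -scalemxAr.
by rewrite [in RHS]addrA -scalerDr -[a - _ + _]addrA [- _ + x *m P]addrC.
Qed.

Lemma affine_subspace_refl j U : affine_subspace j U ->
  exists c P, orthproj_mx j P /\ reflection U = (fun x => c + x *m refl_mx P).
Proof.
move=> [a [V [<- ->]]]; have [c ->] := reflection_flat a V.
by exists c, (proj_mx V (kermx V^T)); split=> //; exact: orthproj_mx_flat.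
Qed.

(** The way back from matrices to subspaces: a matrix found by compactness yields a subspace that
    bounds [chirality] from above. In [x = (x - x P) + x P] the first summand is orthogonal to the
    row space of [P]. *)
Lemma orthproj_mx_reflection j P : orthproj_mx j P ->
  affine_subspace j (flat 0 P) /\
  reflection (flat 0 P) = (fun x => x *m refl_mx P).
Proof.
move=> Pj; split; first by exists 0, P; rewrite (orthproj_mx_rank Pj).
have [PT PP _] := Pj; apply/funext => x.
rewrite /reflection orthprojE add0r subr0 /refl_mx mulmxBr mulmx1 -scalemxAr.
congr (_ *: _ - _); rewrite -[in LHS](subrK (x *m P) x) mulmxDl.
rewrite proj_mx_0 ?capmx_kermx_tr ?add0r//; last first.
  by apply/sub_kermxP; rewrite PT mulmxBl -mulmxA PP subrr.
by rewrite proj_mx_id ?capmx_kermx_tr ?submxMl.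
Qed.

Lemma affine_subspace_nonempty j : (j <= n)%N ->
  @affine_subspace R n j !=set0.
Proof.
move=> jn; exists (flat 0 (pid_mx j)), 0, (pid_mx j).
by rewrite rank_pid_mx.
Qed.

End Reflections.

(** * Continuity and compactness in matrix spaces *)

Section MatrixTopology.
Context {R : realType}.

Lemma mx_continuous (T : topologicalType) m n (f : T -> 'M[R]_(m, n)) :
  (forall i j, continuous (fun x => f x i j)) -> continuous f.
Proof.
move=> fc x A [B nB BA]; apply: (@filterS _ (nbhs x) _
  [set y | forall i j, B i j (f y i j)]); first by move=> y /BA.
by apply: filter_forall => i; apply: filter_forall => j; exact/fc/nB.
Qed.

Lemma continuous_entry (T : topologicalType) m n (f : T -> 'M[R]_(m, n)) i j :
  continuous f -> continuous (fun x => f x i j).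
Proof.
move=> fc x; apply: (@continuous_comp _ _ _ f (fun M : 'M[R]_(m, n) => M i j)).
  exact: fc.
exact: coord_continuous.
Qed.

Lemma mulmx_continuous (T : topologicalType) m n p
    (f : T -> 'M[R]_(m, n)) (g : T -> 'M[R]_(n, p)) :
  continuous f -> continuous g -> continuous (fun x => f x *m g x).
Proof.
move=> fc gc; apply: mx_continuous => i j.
rewrite [X in continuous X](_ : _ = fun x => \sum_k f x i k * g x k j); last first.
  by apply/funext => x; rewrite mxE.
move=> x.
apply: cvg_big => [|k _]; first exact: add_continuous.
by apply: cvgM; exact: continuous_entry.
Qed.

Lemma trmx_continuous m n : continuous (fun A : 'M[R]_(m, n) => A^T).
Proof.
apply: mx_continuous => i j.
rewrite [X in continuous X](_ : _ = fun A : 'M[R]_(m, n) => A j i).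
  exact: coord_continuous.
by apply/funext => A; rewrite mxE.
Qed.

Lemma mxtrace_continuous n : continuous (fun A : 'M[R]_n => \tr A).
Proof.
move=> A; have FA := nbhs_filter A; apply: cvg_big => [|k _]; first exact: add_continuous.
exact: coord_continuous.
Qed.

(** Compactness of products of row vectors is applied twice, within each row and then to the row of
    rows, and carried over to matrices by [f]. *)
Lemma mx_box_compact m n (A : 'I_m -> 'I_n -> set R) :
  (forall i j, compact (A i j)) ->
  compact [set M : 'M[R]_(m, n) | forall i j, A i j (M i j)].
Proof.
move=> Ac.
pose f (N : 'rV['rV[R]_n]_m) : 'M[R]_(m, n) := \matrix_(i, j) N 0 i 0 j.
have fc : continuous f.
  apply: mx_continuous => i j N B /= /[!mxE] NB.
  have : nbhs (N 0 i) [set v : 'rV[R]_n | B (v 0 j)] by exact: coord_continuous NB.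
  (* Only row [i] is constrained; the premise [k = i] leaves the other rows free. *)
  move=> NB'; exists (fun _ k => [set v : 'rV[R]_n | k = i -> B (v 0 j)]).
    move=> i0 k; rewrite ord1; have [->|ki] := eqVneq k i.
      by apply: filterS NB' => v Bv _.
    by apply: filterE => v /= kiE; rewrite kiE eqxx in ki.
  by move=> N' /(_ 0 i)/= BN'; rewrite mxE; exact: BN'.
have := @rV_compact _ _ _ (fun i => rV_compact (Ac i)).
move=> /(continuous_compact (continuous_subspaceT fc)); congr (compact _).
apply/seteqP; split=> [_ [N NA <-] i j|M MA]; first by rewrite mxE; exact: NA.
exists (\row_i row i M); first by move=> i j; rewrite !mxE; exact: MA.
by apply/matrixP => i j; rewrite !mxE.
Qed.

Lemma closed_fiber (S T : topologicalType) (f : S -> T) (a : T) :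
  hausdorff_space T -> continuous f -> closed [set x | f x = a].
Proof.
move=> hT /continuous_closedP fc; apply: (fc [set a]).
exact/accessible_closed_set1/hausdorff_accessible.
Qed.

(** Continuous equations cut out a closed set. It is bounded because [P i i] is the sum of the
    squares of row [i]: first [P i i <= 1], then every entry of the row has square at most 1. *)
Lemma orthproj_mx_compact n j : compact [set P : 'M[R]_n | orthproj_mx j P].
Proof.
apply: (@subclosed_compact _ _
  [set P : 'M[R]_n | forall i k, `[-1, 1]%classic (P i k)]).
- rewrite [X in closed X](_ : _ = [set P : 'M[R]_n | P^T - P = 0] `&`
    [set P : 'M[R]_n | P *m P - P = 0] `&` [set P : 'M[R]_n | \tr P = j%:R]).
    apply: closedI; first apply: closedI.
    + apply: closed_fiber; first exact: norm_hausdorff.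
      move=> P; have FP := nbhs_filter P.
      by apply: cvgB; [exact: trmx_continuous|exact: cvg_id].
    + apply: closed_fiber; first exact: norm_hausdorff.
      move=> P; have FP := nbhs_filter P; apply: cvgB; last exact: cvg_id.
      have idc : continuous (fun P : 'M[R]_n => P) by move=> ?; exact: cvg_id.
      exact: (mulmx_continuous idc idc).
    + exact: (closed_fiber (@Rhausdorff R) (@mxtrace_continuous n)).

  apply/seteqP; split=> [P [PT PP tP]|P [[/subr0_eq PT /subr0_eq PP] tP]] //.
  by split=> //; split; rewrite /= ?PT ?PP subrr.
- apply: (@mx_box_compact n n (fun _ _ => `[-1, 1]%classic)) => i k.
  exact: segment_compact.
move=> P [PT PP _] i k.
have PE : P i i = \sum_l P i l ^+ 2.
  rewrite -{1}PP mxE; apply: eq_bigr => l _.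
  by rewrite -{2}PT mxE expr2.
have Pge l : P i l ^+ 2 <= P i i.
  rewrite PE (bigD1 l)//= lerDl; apply: sumr_ge0 => m _; exact: sqr_ge0.
have Pii : P i i <= 1 by have := Pge i; rewrite expr2; nra.
have := Pge k; rewrite /= in_itv/= expr2 => Pik.
by apply/andP; split; nra.
Qed.

(** The set is the projection to [S] of a closed subset of the compact product. *)
Lemma compact_exists (S T V : topologicalType) (A : set S) (B : set T)
    (f : S * T -> V) (a : V) : hausdorff_space V -> continuous f ->
  compact A -> compact B ->
  compact [set s | A s /\ exists2 t, B t & f (s, t) = a].
Proof.
move=> hV fc Ac Bc.
have := compact_closedI (compact_setX Ac Bc) (closed_fiber (a := a) hV fc).
have : continuous (@fst S T) by move=> x; exact: cvg_fst.
move=> /continuous_subspaceT/continuous_compact/[apply]; congr (compact _).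
apply/seteqP; split=> [_ [[s t] [[As Bt] fa] <-]|s [As [t Bt fa]]].
  by split=> //; exists t.
by exists (s, t).
Qed.

End MatrixTopology.

Lemma continuous_fst (S T U : topologicalType) (f : S -> T * U) :
  continuous f -> continuous (fun x => (f x).1).
Proof. by move=> fc x; apply: (cvg_comp _ _ (fc x)); exact: cvg_fst. Qed.

Lemma continuous_snd (S T U : topologicalType) (f : S -> T * U) :
  continuous f -> continuous (fun x => (f x).2).
Proof. by move=> fc x; apply: (cvg_comp _ _ (fc x)); exact: cvg_snd. Qed.

(** * Chirality: comparison of two bodies, and attainment of the infimum *)

Section Chirality.
Context {R : realType} {n : nat}.
Implicit Types (K L : set 'rV[R]_n) (c z : 'rV[R]_n) (P M : 'M[R]_n).

Lemma affine_continuous c M : continuous (fun x : 'rV[R]_n => (x - c) *m M).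
Proof.
apply: mulmx_continuous; last exact: cst_continuous.
move=> x; have Fx := nbhs_filter x.
by apply: cvgB; [exact: cvg_id|exact: cvg_cst].
Qed.

(** As [M] is its own inverse, the image is the preimage of [L] under the continuous map
    [x -> (x - c) M]. *)
Lemma interior_affine c M L : M *m M = 1%:M -> L° !=set0 ->
  [set c + x *m M | x in L]° !=set0.
Proof.
move=> MM [y Ly]; exists (c + y *m M).
have yE : y = (c + y *m M - c) *m M by rewrite addrC addKr -mulmxA MM mulmx1.
have /(affine_continuous (x := c + y *m M)) : nbhs ((c + y *m M - c) *m M) L.
  by rewrite -yE.
apply: (@filterS _ (nbhs (c + y *m M))) => x /= Lx; exists ((x - c) *m M) => //.
by rewrite -mulmxA MM mulmx1 subrKC.
Qed.

Lemma cover_factors_reflection j K L U : affine_subspace j U ->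
  compact K -> L° !=set0 -> cover_factors K (reflection U @` L) !=set0.
Proof.
move=> /affine_subspace_refl[c [P [Pj ->]]] Kc L0.
apply: cover_factors_nonempty => //; apply: interior_affine => //.
exact: refl_mx_invol Pj.
Qed.

Lemma chirality_ge0 j K : 0 <= chirality j K.
Proof.
rewrite /chirality; set S := (X in inf X).
have [->|/set0P Sn] := eqVneq S set0; first by rewrite inf0.
by apply: lb_le_inf => // _ [U _ <-]; exact: circumradius_ge0.
Qed.

Lemma chirality_le j K U :
  affine_subspace j U -> chirality j K <= circumradius K (reflection U @` K).
Proof.
move=> Uj; apply: ge_inf; last by exists U.
by exists 0 => _ [V _ <-]; exact: circumradius_ge0.
Qed.

Lemma chirality_le_circumradius j K L : (j <= n)%N ->
  convex_body K -> convex_body L ->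
  chirality j K <= circumradius K L * circumradius L K * chirality j L.
Proof.
move=> jn [Kc _ K0] [Lc _ L0].
rewrite /chirality -/(chirality j K); apply: le_mul_inf.
- have [U Uj] := affine_subspace_nonempty (R := R) jn.
  by exists (circumradius L (reflection U @` L)), U.
- by rewrite mulr_ge0// circumradius_ge0.
move=> _ [U Uj <-].
have KL := cover_factors_nonempty Kc L0.
have LK := cover_factors_nonempty Lc K0.
have LUL := cover_factors_reflection Uj Lc L0.
have LUK := cover_factors_reflection Uj Lc K0.
apply: (le_trans (chirality_le K Uj)).
apply: (le_trans (circumradius_mul KL LUK)).
rewrite -mulrA ler_wpM2l ?circumradius_ge0//.
have [c [P [Pj UE]]] := affine_subspace_refl Uj.
(* The same affine map acts on both bodies, so the last link of the chain of covers costs no more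
   than [circumradius L K]. *)
have ULK : circumradius (reflection U @` L) (reflection U @` K)
    <= circumradius L K by rewrite UE; exact: circumradius_affine.
have ULUK : cover_factors (reflection U @` L) (reflection U @` K) !=set0.
  apply: cover_factors_nonempty; last first.
    by rewrite UE; apply: interior_affine => //; exact: refl_mx_invol Pj.
  apply: continuous_compact Lc; apply: continuous_subspaceT => x.
  have Fx := nbhs_filter x; rewrite UE; apply: cvgD; first exact: cvg_cst.
  have idc : continuous (fun y : 'rV[R]_n => y) by move=> ?; exact: cvg_id.
  exact: (mulmx_continuous idc (@cst_continuous _ _ _)).
apply: (le_trans (circumradius_mul LUL ULUK)).
by rewrite mulrC ler_wpM2r ?circumradius_ge0.
Qed.

(* The translation vector is eliminated by requiring that the base point [x0] of [K]
   is covered by the image of some point of the compact set [K]. *)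
Lemma cover_refl_compact j K x0 b : compact K -> K x0 ->
  compact [set l : R | 0 <= l <= b /\ exists P z, orthproj_mx j P /\
    K `<=` homothet z l [set x *m refl_mx P | x in K]].
Proof.
move=> Kc Kx0.
(* A parameter is [(P, (y0, l))], where [y0] is the point of [K] whose image covers [x0]; the
   translation is then [x0 - l *: (y0 *m refl_mx P)]. *)
pose Q := [set P : 'M[R]_n | orthproj_mx j P] `*` (K `*` `[0, b]%classic).
pose f (q : ('M[R]_n * ('rV[R]_n * R)) * 'rV[R]_n) :=
  q.1.2.2 *: ((q.2 - q.1.2.1) *m refl_mx q.1.1).
have Qc : compact Q.
  apply: compact_setX; first exact: orthproj_mx_compact.
  by apply: compact_setX => //; exact: segment_compact.
have fc : continuous f.
  have idc : continuous (@idfun (('M[R]_n * ('rV[R]_n * R)) * 'rV[R]_n)).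
    by move=> q; exact: cvg_id.
  have c12 := continuous_snd (continuous_fst idc).
  move=> q; have Fq := nbhs_filter q; apply: cvgZ; first exact: continuous_snd c12 q.
  have c1 : continuous (fun q : ('M[R]_n * ('rV[R]_n * R)) * 'rV[R]_n =>
      q.2 - q.1.2.1).
    move=> {Fq}q; have Fq := nbhs_filter q; apply: cvgB.
      exact: continuous_snd idc q.
    exact: continuous_fst c12 q.
  have c2 : continuous (fun q : ('M[R]_n * ('rV[R]_n * R)) * 'rV[R]_n =>
      refl_mx q.1.1).
    move=> {Fq}q; have Fq := nbhs_filter q; apply: cvgB; last exact: cvg_cst.
    by apply: cvgZr; exact: continuous_fst (continuous_fst idc) q.
  exact: (mulmx_continuous c1 c2).
(* [E x] holds the parameters whose cover reaches [x]; intersecting over [K] expresses the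
   inclusion, and [g] then extracts the factor. *)
pose E x := [set q | Q q /\ exists2 y, K y & f (q, y) = x - x0].
have Ec x : compact (E x).
  by apply: compact_exists => //; exact: norm_hausdorff.
have EIc : compact (\bigcap_(x in K) E x).
  apply: (subclosed_compact _ (Ec x0)); last by move=> q /(_ _ Kx0).
  by apply: closed_bigI => x _; apply: compact_closed (Ec x); exact: norm_hausdorff.
pose g (q : 'M[R]_n * ('rV[R]_n * R)) := q.2.2.
have gc : continuous g.
  by do 2!apply: continuous_snd; move=> q; exact: cvg_id.
have := continuous_compact (continuous_subspaceT gc) EIc.
congr (compact _); apply/seteqP; split.
  move=> _ [[P [y0 l]] EI <-]; have [[Pj [Ky0 l0b]] _] := EI _ Kx0.
  rewrite /g/=; move: l0b; rewrite /= in_itv/= => l0b; split=> //.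
  exists P, (x0 - l *: (y0 *m refl_mx P)); split=> // x Kx.
  have [_ [y Ky]] := EI _ Kx; rewrite /f/= => yE.
  exists (y *m refl_mx P); first by exists y.
  by rewrite -[RHS](subrKC x0) -yE mulmxBl scalerBr addrAC addrA.
move=> l [l0b [P [z [Pj KP]]]].
have [_ [y0 Ky0 <-] y0E] := KP _ Kx0.
exists (P, (y0, l)) => //= x Kx; split.
  by split=> //; split=> //=; rewrite in_itv.
have [_ [y Ky <-] yE] := KP _ Kx; exists y => //.
by rewrite /f/= -yE -y0E mulmxBl scalerBr opprD addrACA subrr add0r.
Qed.

(** The infimum over [U] of infima over cover factors is a limit of factors of actual covers, and
    these form a closed set by [cover_refl_compact]. *)
Lemma chirality_attained j K : (j <= n)%N -> compact K -> K° !=set0 ->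
  0 < chirality j K ->
  exists P z, orthproj_mx j P /\
    K `<=` homothet z (chirality j K) [set x *m refl_mx P | x in K].
Proof.
move=> jn Kc K0 a0.
have [x0 Kx0] : K !=set0 by have [x /interior_subset] := K0; exists x.
have := compact_closed (@Rhausdorff R)
  (@cover_refl_compact j K x0 (chirality j K + 1) Kc Kx0).
move=> /(_ (chirality j K)) []; last by [].
move=> B /nbhs_ballP[e /= e0 eB].
(* The cap 1 keeps the approximating factors below the bound [chirality j K + 1] of the compact
   set. *)
pose d := Num.min e 1.
have d0 : 0 < d by rewrite lt_min e0/=.
have hi : has_inf [set circumradius K (reflection U @` K) | U in affine_subspace j].
  split; last by exists 0 => _ [V _ <-]; exact: circumradius_ge0.
  have [U Uj] := affine_subspace_nonempty (R := R) jn.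
  by exists (circumradius K (reflection U @` K)), U.
have [_ [U Uj <-]] := inf_adherent d0 hi; rewrite -/(chirality j K) => Ud.
have hc : has_inf (cover_factors K (reflection U @` K)).
  split; first exact: cover_factors_reflection Uj Kc K0.
  by exists 0 => l [/ltW].
have := Ud; rewrite -subr_gt0 => /inf_adherent/(_ hc)[l [l0 [z KU]]].
rewrite -/(circumradius _ _) subrKC => ld.
have al : chirality j K <= l.
  exact: le_trans (chirality_le K Uj) (circumradius_le l0 KU).
have ld1 : l < chirality j K + e by rewrite (lt_le_trans ld)// lerD2l ge_min lexx.
have ld2 : l < chirality j K + 1.
  by rewrite (lt_le_trans ld)// lerD2l ge_min lexx orbT.
exists l; split; last by apply: eB; rewrite /ball/= ltr_norml; apply/andP; split; lra.
split; first by apply/andP; split; exact: ltW.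
have [c [P [Pj UE]]] := affine_subspace_refl Uj.
exists P, (z + l *: c); split=> // x /KU[_ [y Ky <-] <-].
exists (y *m refl_mx P); first by exists y.
by rewrite UE scalerDr addrA.
Qed.

End Chirality.

(** * Bodies of prescribed chirality between a body and a symmetric one *)

Section Interpolation.
Context {R : realType} {n : nat}.
Implicit Types (K L : set 'rV[R]_n).

Lemma convex_setP K : convex_set K <->
  forall x y (t : R), K x -> K y -> 0 <= t -> t <= 1 ->
    K (t *: x + (1 - t) *: y).
Proof.
split=> [Kc x y t Kx Ky t0 t1|Kc x y t].
  by have := Kc x y (Itv01 t0 t1); rewrite !inE; apply.
by rewrite !inE => Kx Ky; apply: Kc.
Qed.

(* If [K] is covered by its [a]-fold enlarged mirror image about the point
   [-w], its intersection with the [b]-fold mirror image interpolates between [K]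
   (at [b = a]) and a symmetric body (at [b = 1]). *)
Lemma mirror_body (M : 'M[R]_n) (a b : R) (w : 'rV[R]_n) K : M *m M = 1%:M ->
  1 < a -> 1 <= b <= a -> convex_body K ->
  (forall x, K x -> K (a^-1 *: ((x + w) *m M) - w)) ->
  exists L, [/\ convex_body L,
    L `<=` homothet 0 b [set x *m M | x in L],
    circumradius K L <= a / b & circumradius L K <= 1].
Proof.
move=> MM a1 /andP[b1 ba] [Kc Kconv K0] KM.
have a0 : 0 < a by lra.
have b0 : 0 < b by lra.
have Kcl : closed K by apply: compact_closed => //; exact: norm_hausdorff.
(* The map in the hypothesis contracts towards [- w]. Its square is free of [M] and has ratio [q],
   so iterating it gives points of the closed set [K] converging to [- w]. *)
have Kw : K (- w).
  have [x0 /interior_subset Kx0] := K0.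
  pose q := a^-1 ^+ 2.
  have Kq k : K (q ^+ k *: (x0 + w) - w).
    elim: k => [|k /KM/KM]; first by rewrite expr0 scale1r addrK.
    by rewrite !subrK -!scalemxAl -mulmxA MM mulmx1 !scalerA mulrA -expr2 -exprS.
  have q0 : (fun k => q ^+ k) @ \oo --> (0 : R).
    apply: cvg_expr; rewrite ger0_norm ?sqr_ge0// expr_lt1 ?invr_ge0 ?ltW//.
    by rewrite invf_lt1.
  have : (fun k => q ^+ k *: (x0 + w) - w) @ \oo --> 0 *: (x0 + w) - w.
    by apply: cvgB; [exact: cvgZr_tmp|exact: cvg_cst].
  by rewrite scale0r add0r; apply: closed_cvg => //; exact: nearW.
(* [K'] is [K] moved so that the fixed point [- w] becomes the origin. *)
pose K' := [set y | K (y - w)].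
have K'c y t : K' y -> 0 <= t -> t <= 1 -> K' (t *: y).
  rewrite /K'/= => Ky t0 t1.
  have := (convex_setP K).1 Kconv _ _ t Ky Kw t0 t1.
  by congr K; rewrite scalerN scalerBl scale1r scalerBr opprB addrA subrK.
have K'M y : K' y -> K' (a^-1 *: (y *m M)) by move=> /KM; rewrite subrK.
(* Since [M] is an involution, the second set is the [b]-fold mirror image of [K']. *)
pose L := K' `&` [set y | K' (b^-1 *: (y *m M))].
have KL y : K' y -> L ((b / a) *: y).
  move=> Ky; split.
    by apply: K'c => //; rewrite ?ler_pdivrMr ?mul1r// divr_ge0// ltW.
  by rewrite /= -scalemxAl scalerA mulrA mulVf ?gt_eqF// mul1r; exact: K'M.
have fc (c : R) (M' : 'M[R]_n) : continuous (fun y : 'rV[R]_n => c *: (y *m M') - w).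
  move=> y; have Fy := nbhs_filter y; apply: cvgB; last exact: cvg_cst.
  have idc : continuous (fun y : 'rV[R]_n => y) by move=> ?; exact: cvg_id.
  by apply: cvgZr; exact: (mulmx_continuous idc (@cst_continuous _ _ _) (x := y)).
exists L; split.
- split.
  + apply: compact_closedI; last first.
      exact: ((continuous_closedP _).1 (fc b^-1 M)).
    rewrite (_ : K' = [set x + w | x in K]).
      apply: continuous_compact Kc; apply: continuous_subspaceT => x.
      by have Fx := nbhs_filter x; apply: cvgD; [exact: cvg_id|exact: cvg_cst].
    apply/seteqP; split=> [y Ky|_ [x Kx <-]]; first by exists (y - w); rewrite ?subrK.
    by rewrite /K'/= addrK.
  + apply/convex_setP => x y t [Kx Kx'] [Ky Ky'] t0 t1; split.
      rewrite /K'/=; have := (convex_setP K).1 Kconv _ _ t Kx Ky t0 t1.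
      congr K; rewrite !scalerBr addrACA; congr (_ + _).
      by rewrite -opprD -scalerDl subrKC scale1r.
    rewrite /K'/=; have := (convex_setP K).1 Kconv _ _ t Kx' Ky' t0 t1.
    congr K; rewrite !scalerBr addrACA mulmxDl -!scalemxAl scalerDr !scalerA.
    rewrite ![b^-1 * _]mulrC; congr (_ + _).
    by rewrite -opprD -scalerDl subrKC scale1r.
  (* Interior points of [K'] scaled by [b / a] are interior to [L]; the factor [1%:M] is there to
     reuse [fc]. *)
  + have [k Kk] := K0; exists ((b / a) *: (k + w)).
    have kE : k = (a / b) *: (((b / a) *: (k + w)) *m 1%:M) - w.
      by rewrite mulmx1 scalerA mulrA divfK ?gt_eqF// divff ?gt_eqF// scale1r addrK.
    have := @fc (a / b) 1%:M ((b / a) *: (k + w)) K; rewrite -kE => /(_ Kk).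
    apply: (@filterS _ (nbhs ((b / a) *: (k + w)))) => y /=; rewrite mulmx1 => Ky.
    have := KL ((a / b) *: y) Ky; congr L.
    by rewrite scalerA mulrA divfK ?gt_eqF// divff ?gt_eqF// scale1r.
(* The preimage [b^-1 *: (y *m M)] is again in [L]: its own second condition concerns [b^-2 *: y],
   which is in [K'] as [b >= 1]. *)
- move=> y [Ky KyM]; exists (b^-1 *: (y *m M) *m M).
    exists (b^-1 *: (y *m M)) => //; split=> //.
    rewrite /= -scalemxAl -mulmxA MM mulmx1 scalerA; apply: K'c => //.
      by rewrite mulr_ge0// invr_ge0 ltW.
    by rewrite -invfM invf_le1 ?mulr_gt0//; nra.
  by rewrite add0r -scalemxAl -mulmxA MM mulmx1 scalerA divff ?gt_eqF// scale1r.
- apply: (@circumradius_le _ _ _ _ (- w)); first exact: divr_gt0.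
  move=> x Kx; exists ((b / a) *: (x + w)); first by apply: KL; rewrite /K'/= addrK.
  by rewrite scalerA mulrA divfK ?gt_eqF// divff ?gt_eqF// scale1r addrC addrK.
- apply: (@circumradius_le _ _ _ _ w) => // y [Ky _].
  by exists (y - w) => //; rewrite scale1r subrKC.
Qed.

(* A cover by the mirror image with translation [z] becomes centred after moving [K]
   by the solution [w] of [a w M - w = z], which exists because [M] is an involution
   and [a <> 1]. *)
Lemma interpolating_body (M : 'M[R]_n) (a b : R) (z : 'rV[R]_n) K :
  M *m M = 1%:M -> 1 <= b <= a -> convex_body K ->
  K `<=` homothet z a [set x *m M | x in K] ->
  exists L z', [/\ convex_body L,
    L `<=` homothet z' b [set x *m M | x in L],
    circumradius K L <= a / b & circumradius L K <= 1].
Proof.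
move=> MM /andP[b1 ba] Kb KM.
have K1 : circumradius K K <= 1.
  by apply: (@circumradius_le _ _ _ _ 0) => // x Kx; exists x; rewrite // scale1r add0r.
(* For [a <= 1] the bounds force [a = b = 1], and [K] itself serves. *)
have [a1|a1] := leP a 1.
  have -> : b = a by lra.
  by exists K, z; split=> //; rewrite divff//; apply/eqP; lra.
have a2 : a ^+ 2 - 1 != 0 by rewrite gt_eqF// subr_gt0 expr_gt1//; lra.
(* From [(a M + 1) (a M - 1) = a^2 - 1], a consequence of [M *m M = 1%:M]. *)
pose w := (a ^+ 2 - 1)^-1 *: (z *m (a *: M + 1%:M)).
have wE : a *: (w *m M) - w = z.
  rewrite /w -scalemxAl -mulmxA mulmxDl mul1mx -scalemxAl MM.
  rewrite scalerA mulrC -scalerA -scalerBr !mulmxDr -!scalemxAr !mulmx1.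
  rewrite [a *: (_ + _)]scalerDr [a *: (a *: _)]scalerA -expr2 opprD addrA addrK.
  rewrite -{2}[z]scale1r -scalerBl.
  by rewrite scalerA mulVf// scale1r.
have [||L [Lb LM KL LK]] := @mirror_body M a b w K MM a1 _ Kb.
  by rewrite b1.
  (* With [x = z + a k M], the point required to be in [K] turns out to be [k]. *)
  move=> x /KM[_ [k Kk <-] <-].
  have zM : z *m M = a *: w - w *m M.
    by rewrite -wE mulmxBl -scalemxAl -mulmxA MM mulmx1.
  rewrite !mulmxDl zM -scalemxAl -mulmxA MM mulmx1 addrAC subrK -scalerDr scalerA.
  by rewrite mulVf ?scale1r 1?addrC ?addKr//; apply/eqP; lra.
by exists L, 0.
Qed.

End Interpolation.

(** * The bound and its sharpness *)

Theorem theorem3p5 (R : realType) (n j : nat) (hj : (j <= n)%N) :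
  (forall K L : set 'rV[R]_n, convex_body K -> convex_body L ->
     Num.max (chirality j K / chirality j L) (chirality j L / chirality j K)
       <= circumradius K L / inradius K L
     /\ circumradius K L / inradius K L = circumradius L K / inradius L K)
  /\
  (forall K : set 'rV[R]_n, convex_body K ->
     forall beta : R, 1 <= beta <= chirality j K ->
     exists L : set 'rV[R]_n,
       [/\ convex_body L,
           chirality j L = beta &
           Num.max (chirality j K / chirality j L)
                   (chirality j L / chirality j K)
             = circumradius K L / inradius K L]).
Proof.
have ratio_le (K L : set 'rV[R]_n) : convex_body K -> convex_body L ->
    chirality j K / chirality j L <= circumradius K L * circumradius L K.
  (* If [chirality j L] is 0, the quotient is 0 by the convention for inverses. *)
  move=> Kb Lb; have := chirality_ge0 j L; rewrite le_eqVlt => /predU1P[<-|L0].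
    by rewrite invr0 mulr0 mulr_ge0// circumradius_ge0.
  by rewrite ler_pdivrMr//; exact: chirality_le_circumradius.
split=> [K L Kb Lb|K Kb b /andP[b1 ba]].
  (* Both ratios become the product of the two circumradii, symmetric in [K] and [L]. *)
  rewrite !inradiusE !invrK [circumradius L K * _]mulrC; split=> //.
  by rewrite ge_max ratio_le//= [leRHS]mulrC ratio_le.
have [Kc _ K0] := Kb.
have a0 : 0 < chirality j K by lra.
have b0 : 0 < b by lra.
have [P [z [Pj KP]]] := chirality_attained hj Kc K0 a0.
have [|L [z' [Lb LP KL LK]]] := interpolating_body (refl_mx_invol Pj) _ Kb KP (b := b).
  by rewrite b1.
have [Uj UE] := orthproj_mx_reflection Pj.
have Lle : chirality j L <= b.
  apply: le_trans (chirality_le L Uj) _; rewrite UE.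
  exact: circumradius_le LP.
have RR : circumradius K L * circumradius L K <= chirality j K / b.
  rewrite -[leRHS]mulr1; apply: ler_pM => //; exact: circumradius_ge0.
have KLb := chirality_le_circumradius hj Kb Lb.
(* Cancelling [chirality j K] in the general bound turns the upper estimate [RR] into a lower
   estimate for [chirality j L]. *)
have bL : b <= chirality j L.
  have : chirality j K <= chirality j K / b * chirality j L.
    by apply: le_trans KLb _; rewrite ler_wpM2r// chirality_ge0.
  by rewrite -mulrA -ler_pdivrMl// mulVf ?gt_eqF// mulrC ler_pdivlMr// mul1r.
have LE : chirality j L = b by apply/eqP; rewrite eq_le Lle.
exists L; split=> //.
(* The first quotient is the larger one because [b <= chirality j K]; it equals the product of
   circumradii by [RR] and [KLb]. *)
rewrite inradiusE invrK LE max_l.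
  by apply/eqP; rewrite eq_le RR andbT ler_pdivrMr// -LE.
rewrite ler_pdivrMr// mulrAC ler_pdivlMr// -!expr2.
by rewrite ler_sqr ?nnegrE// ltW.
Qed.
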